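(* Let $G=(V,E)$ be a connected simple graph on $n$ vertices, and equip it with the minimum degree conductance function $c(u,v)=\frac{1}{\min[d(u),d(v)]}$ for every edge $(u,v)\in E$. Then the cyclic cover time of the associated random walk satisfies $CYC[G,c]\le 18n^2$.
   Context: For a vertex $v$, $d(v)$ is its degree and $N(v)$ its set of neighbors. Given a connected graph $G$ and a conductance function $c:E\to\mathbb{R}_{\ge 0}$ (such that the edges of positive conductance form a connected spanning subgraph), the associated random walk is the Markov chain on $V$ which from the current vertex $v$ moves to $u\in N(v)$ with probability $\frac{c(v,u)}{\sum_{w\in N(v)}c(v,w)}$. For vertices $u,v$, the hitting time $H[u,v]$ is the expected number of steps for the walk started at $u$ to reach $v$. The cyclic cover time is $CYC[G,c]=\min_{\sigma}\left(H[v_{\sigma(1)},v_{\sigma(2)}]+\dots+H[v_{\sigma(n-1)},v_{\sigma(n)}]+H[v_{\sigma(n)},v_{\sigma(1)}]\right)$, the minimum over all orderings $\sigma$ of the vertices $v_1,\dots,v_n$. *)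

(* Defs.v *)
From HB Require Import structures.
From mathcomp Require Import all_boot all_order all_algebra.
Set Implicit Arguments. Unset Strict Implicit. Unset Printing Implicit Defensive.
Import Order.TTheory GRing.Theory Num.Theory.
Local Open Scope ring_scope.

Section RW.
Variable T : finType.

Definition deg (e : rel T) (v : T) : nat := #|[set w | e v w]|.

Definition mindeg_cond (e : rel T) (u w : T) : rat :=
  if e u w then ((minn (deg e u) (deg e w))%:R)^-1 else 0.

Definition trans (c : T -> T -> rat) (u w : T) : rat :=
  c u w / (\sum_(w' : T) c u w').

(* avoid c v t u = Prob_u(X_0 <> v, ..., X_t <> v) = Prob_u(T_v > t),
   computed as the sum over walks of the products of transition probabilities *)
Fixpoint avoid (c : T -> T -> rat) (v : T) (t : nat) (u : T) : rat :=
  match t with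
  | 0 => (u != v)%:R
  | t'.+1 => (u != v)%:R * \sum_(w : T) trans c u w * avoid c v t' w
  end.

(* N-th partial sum of the hitting time series
   H[u,v] = E_u[T_v] = \sum_{t >= 0} Prob_u(T_v > t) *)
Definition hitN (c : T -> T -> rat) (N : nat) (u v : T) : rat :=
  \sum_(t < N) avoid c v t u.

Definition cyc_partial (c : T -> T -> rat) (N : nat) (s : seq T) : rat :=
  \sum_(p <- zip s (rot 1 s)) hitN c N p.1 p.2.

End RW.

(* Main.v *)
(** Let [c] be the minimum degree conductance, [m] the sum of [c u v] over ordered
    pairs, and [R] the effective resistance.  Then [m <= 2 n], the commute time of
    [u, v] is [m * R u v], and Foster's identity says that [c * R] sums to [n - 1]
    over the edges.  Hitting times satisfy the triangle inequality, so every
    spanning tree yields a cyclic order of cost at most [m] times its total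
    resistance, and it suffices to find a tree of total resistance at most [8 n].

    This holds for any edge weight [R] bounded by the minimum degree of the
    endpoints and satisfying Foster's identity.  Run Kruskal's algorithm with time
    [t] equal to the current weight, and amortize over the components [A] the
    quantity (tree weight inside [A]) + [t].  While the edge boundary of [A] has
    conductance at least 1/2, the passage of time is paid by the boundary edges, whose
    weight is at least [t].  Otherwise each vertex has at least half of its
    neighbours in [A], and time is paid by the credit collected from those
    neighbours: two units each, kept in [slack] through [invariant]. *)
Require Import Defs.
From HB Require Import structures.
From mathcomp Require Import all_boot all_order all_algebra.
From mathcomp Require Import ring lra.
Import Order.TTheory GRing.Theory Num.Theory.
Local Open Scope ring_scope.
Set Implicit Arguments. Unset Strict Implicit. Unset Printing Implicit Defensive.

(** * Laplacian of a network, hitting times and effective resistance *)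

Section Network.
Variables (T : finType) (c : T -> T -> rat).

Definition laplacian (g : T -> rat) (u : T) : rat :=
  \sum_w c u w * (g u - g w).

Lemma laplacianE g u :
  laplacian g u = (\sum_w c u w) * g u - \sum_w c u w * g w.
Proof.
by rewrite /laplacian mulr_suml -sumrB; apply: eq_bigr => w _; rewrite mulrBr.
Qed.

Lemma laplacian_sub f g u :
  laplacian (fun x => f x - g x) u = laplacian f u - laplacian g u.
Proof. by rewrite -sumrB; apply: eq_bigr => w _; ring. Qed.

Lemma laplacian_addr g a u : laplacian (fun x => g x + a) u = laplacian g u.
Proof. by apply: eq_bigr => w _; ring. Qed.

Lemma laplacian_scale a g u :
  laplacian (fun x => a * g x) u = a * laplacian g u.
Proof. by rewrite mulr_sumr; apply: eq_bigr => w _; ring. Qed.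

Lemma laplacian_sum (G : T -> T -> rat) u :
  laplacian (fun x => \sum_w G w x) u = \sum_w laplacian (G w) u.
Proof.
by rewrite exchange_big; apply: eq_bigr => w _; rewrite -sumrB mulr_sumr.
Qed.

Hypothesis c_ge0 : forall u w, 0 <= c u w.
Hypothesis c_sym : forall u w, c u w = c w u.
Hypothesis c_conn : forall x y, connect [rel u w | 0 < c u w] x y.

(** Minimum principle: at a minimizer other than [v], a strictly larger neighbour would make the
    Laplacian negative. So if [v] is not a minimizer, the minimizers are closed under edges of
    positive conductance, against connectivity. *)
Lemma superharmonic_min v g :
  (forall u, u != v -> 0 <= laplacian g u) -> forall u, g v <= g u.
Proof.
move=> supg u; case: (@arg_minP _ rat T v xpredT g) => // m _ mmin.
have [<-|gmv] := eqVneq (g m) (g v); first exact: mmin.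
pose A := [pred x | g x == g m].
have clA : closed [rel u w | 0 < c u w] A.
  apply: intro_closed; first by apply: sym_connect_sym => x y /=; rewrite c_sym.
  move=> x y /= cxy; rewrite !inE => /eqP gx; apply/eqP.
  have xv : x != v by apply: contraNneq gmv => <-; rewrite gx.
  apply/eqP; rewrite eq_le mmin // andbT leNgt; apply/negP => lt_my.
  have := supg x xv; rewrite leNgt => /negP; apply.
  rewrite /laplacian (bigD1 y) //= gx.
  have rest : \sum_(w | w != y) c x w * (g m - g w) <= 0.
    by apply: sumr_le0 => w _; rewrite mulr_ge0_le0 // subr_le0 mmin.
  have : c x y * (g m - g y) < 0 by rewrite pmulr_rlt0 // subr_lt0.
  lra.
by have := closed_connect clA (c_conn m v); rewrite !inE eqxx eq_sym (negPf gmv).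
Qed.

Lemma harmonic_const g u v : (forall x, laplacian g x = 0) -> g u = g v.
Proof.
by move=> g0; apply/eqP; rewrite eq_le !superharmonic_min // => x _; rewrite g0.
Qed.

Lemma sum_laplacian g : \sum_u laplacian g u = 0.
Proof.
have : \sum_u laplacian g u = \sum_w \sum_u c u w * (g u - g w).
  exact: exchange_big.
have -> : \sum_w \sum_u c u w * (g u - g w) = - \sum_w laplacian g w.
  rewrite -sumrN; apply: eq_bigr => w _; rewrite -sumrN.
  by apply: eq_bigr => u _; rewrite c_sym; ring.
lra.
Qed.

(** Constants span the kernel of the Laplacian, so adding the all-ones matrix gives an invertible
    [M]. Since Laplacians sum to 0, a solution for [M] with right-hand side of sum 0 has sum 0
    itself, and the added matrix contributes nothing. *)
Lemma laplacian_solve f : \sum_u f u = 0 -> exists g, laplacian g =1 f.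
Proof.
move=> sumf0; pose n := #|T|.
pose val (x : 'rV[rat]_n) (u : T) := x 0 (enum_rank u).
pose M : 'M[rat]_n := \matrix_(i, j)
  ((i == j)%:R * \sum_w c (enum_val j) w - c (enum_val j) (enum_val i) + 1).
have MP (x : 'rV_n) j :
    (x *m M) 0 j = laplacian (val x) (enum_val j) + \sum_u val x u.
  rewrite mxE laplacianE; under eq_bigr do rewrite !mxE mulrDr mulr1 mulrBr.
  rewrite big_split sumrB /= (bigD1 j) //= eqxx mul1r /val enum_valK.
  rewrite [X in _ + X - _]big1 => [|i /negPf->]; last by rewrite mul0r mulr0.
  rewrite addr0 mulrC; congr (_ - _ + _).
    rewrite [RHS](reindex (@enum_val T T)) /=.
      by apply: eq_bigr => i _; rewrite enum_valK mulrC.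
    exact: onW_bij (@enum_val_bij T).
  rewrite [RHS](reindex (@enum_val T T)) /=.
    by apply: eq_bigr => i _; rewrite enum_valK.
  exact: onW_bij (@enum_val_bij T).
have val0 x (a : T -> rat) : \sum_u a u = 0 ->
    (forall u, (x *m M) 0 (enum_rank u) = a u) ->
    \sum_u val x u = 0 /\ laplacian (val x) =1 a.
  move=> a0 xM; have lapx u : laplacian (val x) u + \sum_u val x u = a u.
    by rewrite -xM MP enum_rankK.
  have [T0|/card_gt0P [z _]] := posnP #|T|.
    by split; [rewrite big_pred0 // => u|move=> u]; have := fintype0 u T0.
  have : \sum_u (laplacian (val x) u + \sum_u val x u) = 0.
    by rewrite -[RHS]a0; apply: eq_bigr => u _.
  rewrite big_split /= sum_laplacian add0r sumr_const => /eqP.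
  rewrite mulrn_eq0 => /orP[|/eqP s0].
    by rewrite -leqn0 leqNgt (cardD1 z).
  by split=> // u; have := lapx u; rewrite s0 addr0.
have Mu : M \in unitmx.
  rewrite -row_free_unit -kermx_eq0; apply/rowV0P => x /sub_kermxP xM0.
  have [||s0 h0] := val0 x (fun=> 0); first by rewrite big1.
    by move=> u; rewrite xM0 mxE.
  apply/rowP => i; rewrite mxE -[i]enum_valK; set u := enum_val i.
  have : \sum_w val x w = \sum_(w : T) val x u.
    by apply: eq_bigr => w _; apply: harmonic_const.
  rewrite s0 sumr_const => /esym/eqP; rewrite mulrn_eq0 => /orP[|/eqP //].
  by rewrite -leqn0 leqNgt (cardD1 u).
pose x := (\row_j f (enum_val j)) *m invmx M.
exists (val x); apply: (proj2 (val0 x f sumf0 _)) => u.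
by rewrite /x mulmxKV // mxE enum_rankK.
Qed.

Lemma hitting_resistance : (0 < #|T|)%N ->
  exists h R : T -> T -> rat,
  [/\ forall v, h v v = 0, forall u v, 0 <= h u v,
      forall u v, u != v -> h u v = 1 + \sum_w trans c u w * h w v,
      forall u v w, h u w <= h u v + h v w &
      forall u v, h u v + h v u = (\sum_x \sum_y c x y) * R u v] /\
  [/\ forall u v, 0 <= R u v, forall u v, R u v = R v u,
      forall u v, c u v * R u v <= 1 &
      \sum_u \sum_w c u w * R u w = 2 * (#|T|%:R - 1)].
Proof.
move=> T_gt0; set n := #|T| in T_gt0 *.
have n0 : n%:R != 0 :> rat by rewrite pnatr_eq0 -lt0n.
have sum_delta (a : T -> rat) v : \sum_u a u * (u == v)%:R = a v.
  rewrite (bigD1 v) //= eqxx mulr1 big1 ?addr0 // => u /negPf->; exact: mulr0.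
(* [G v] is a Green function with pole [v]; the constant [n%:R^-1] makes the right-hand side sum to
   0. *)
have [G GP] : exists G : T -> T -> rat,
    forall v u, laplacian (G v) u = (u == v)%:R - n%:R^-1.
  apply: (@fin_all_exists T (fun=> T -> rat)
    (fun v g => forall u, laplacian g u = (u == v)%:R - n%:R^-1)) => v.
  apply: laplacian_solve; rewrite sumrB sumr_const -[_ *+ _]mulr_natl mulfV //.
  have := sum_delta (fun=> 1) v; under eq_bigr do rewrite mul1r.
  by move->; rewrite subrr.
pose d u := \sum_w c u w; pose m := \sum_u d u.
(* Chosen so that [h^~ v] vanishes at [v] and has Laplacian [d] elsewhere, which is the first-step
   equation of hitting times. [R u v] is the drop from [u] to [v] of the unit current potential
   [G u - G v]. *)
pose h u v := \sum_w d w * (G w u - G w v) - m * (G v u - G v v).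
pose R u v := G u u + G v v - G u v - G v u.
have lap_h v u : laplacian (h^~ v) u = d u - m * (u == v)%:R.
  rewrite /h laplacian_sub laplacian_scale laplacian_sum.
  rewrite [laplacian (fun x => G v x - _) u]laplacian_addr GP.
  have -> : \sum_w laplacian (fun x => d w * (G w x - G w v)) u
      = d u - m * n%:R^-1.
    rewrite -[d u](sum_delta d) mulr_suml -sumrB; apply: eq_bigr => w _.
    by rewrite laplacian_scale laplacian_addr GP eq_sym; ring.
  ring.
have hvv v : h v v = 0.
  by rewrite /h subrr mulr0 subr0 big1 // => w _; rewrite subrr mulr0.
have d_ge0 u : 0 <= d u by apply: sumr_ge0.
have m_ge0 : 0 <= m by apply: sumr_ge0.
have d_gt0 u v : u != v -> 0 < d u.
  move=> uv; rewrite lt_def d_ge0 andbT; apply: contraNneq uv => du0.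
  have /connectP[[|w p] /= pth ->] := c_conn u v; first by [].
  case/andP: pth => cuw _; have := psumr_eq0P (fun w _ => c_ge0 u w) du0.
  by move=> /(_ w isT) c0; rewrite c0 ltxx in cuw.
have lap_R u v x :
    laplacian (fun x => G u x - G v x) x = (x == u)%:R - (x == v)%:R.
  by rewrite laplacian_sub !GP; ring.
have minR u v x : G u v - G v v <= G u x - G v x.
  apply: (superharmonic_min (g := fun x => G u x - G v x)) => y yv.
  by rewrite lap_R (negPf yv) subr0.
have R_sym u v : R u v = R v u by rewrite /R; ring.
exists h, R; split; split=> //.
- move=> u v; rewrite -(hvv v); apply: (superharmonic_min (g := h^~ v)) => x xv.
  by rewrite lap_h (negPf xv) mulr0 subr0.
- move=> u v uv; have du := d_gt0 _ _ uv; have := lap_h v u.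
  rewrite laplacianE -/(d u) (negPf uv) mulr0 subr0 => hE.
  rewrite /trans; under eq_bigr do rewrite mulrAC.
  rewrite -mulr_suml; apply: (mulfI (lt0r_neq0 du)).
  by rewrite [RHS]mulrDr mulr1 [d u * (_ / _)]mulrC divfK ?lt0r_neq0 //; lra.
- move=> u v w.
  (* As a function of the start, the defect of the triangle inequality is 0 at [v] and has Laplacian
     [m * (x == w)%:R >= 0] off [v]. *)
  suff : h v v + h v w - h v w <= h u v + h v w - h u w by rewrite hvv; lra.
  apply: (superharmonic_min (g := fun x => h x v + h v w - h x w)) => x xv.
  rewrite laplacian_sub laplacian_addr !lap_h (negPf xv) mulr0.
  by have := mulr_ge0 m_ge0 (ler0n _ (x == w)); lra.
- move=> u v; rewrite -/m /h /R.
  suff -> : \sum_w d w * (G w v - G w u) = - \sum_w d w * (G w u - G w v) by ring.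
  by rewrite -sumrN; apply: eq_bigr => w _; ring.
- by move=> u v; have := minR u v u; rewrite /R; lra.
(* The unit current leaving [u] splits into [c u v * R u v] along the edge to [v] and nonnegative
   currents elsewhere, [u] being a maximum of the potential. *)
- move=> u v; have [<-|uv] := eqVneq u v; first by rewrite /R; lra.
  have := lap_R u v u; rewrite eqxx (negPf uv) subr0 => RE; rewrite -[leRHS]RE.
  rewrite /laplacian (bigD1 v) //=.
  have -> : G u u - G v u - (G u v - G v v) = R u v by rewrite /R; ring.
  rewrite lerDl; apply: sumr_ge0 => x _; apply: mulr_ge0 => //.
  by have := minR v u x; lra.
(* Foster's identity: grouping the terms of [R] by pole leaves [laplacian (G u) u = 1 - 1/n] twice
   for each vertex. *)
- have -> : \sum_u \sum_w c u w * R u w =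
      \sum_u laplacian (G u) u + \sum_u laplacian (G u) u.
    have {2}-> : \sum_u laplacian (G u) u =
        \sum_u \sum_w c w u * (G w w - G w u) by exact: exchange_big.
    rewrite -big_split; apply: eq_bigr => u _ /=.
    rewrite -big_split; apply: eq_bigr => w _ /=; rewrite (c_sym w u) /R; ring.
  under eq_bigr do rewrite GP eqxx.
  rewrite sumr_const -[_ *+ _]mulr_natl -/n.
  have -> : true%:R = 1 :> rat by [].
  by field.
Qed.

End Network.

(** * Domination of the partial sums of hitting times *)

Section HittingTime.
Variables (T : finType) (c : T -> T -> rat).
Hypothesis c_ge0 : forall u w, 0 <= c u w.

Lemma hitNS N u v : hitN c N.+1 u v =
  (u != v)%:R * (1 + \sum_w trans c u w * hitN c N w v).
Proof.
rewrite /hitN big_ord_recl /= mulrDr mulr1 -mulr_sumr; congr (_ + _ * _).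
rewrite exchange_big; apply: eq_bigr => w _; by rewrite mulr_sumr.
Qed.

(** The partial sums iterate the first-step equation from 0, hence stay below any nonnegative
    solution, without passing to a limit. *)
Lemma hitN_le h v N u : (forall x, 0 <= h x) ->
  (forall x, x != v -> h x = 1 + \sum_w trans c x w * h w) ->
  hitN c N u v <= h u.
Proof.
move=> h0 hE; elim: N u => [|N IH] u; first by rewrite /hitN big_ord0.
rewrite hitNS; have [_|uv] := eqVneq u v; first by rewrite mul0r.
rewrite mul1r (hE u uv) lerD2l; apply: ler_sum => w _; apply: ler_wpM2l => //.
by rewrite divr_ge0 // sumr_ge0.
Qed.

End HittingTime.

(** * Cyclic orders obtained by joining tours along tree edges *)

Section CyclicTour.
Variables (T : finType) (h : T -> T -> rat).
Hypothesis h_triangle : forall u v w, h u w <= h u v + h v w.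

Definition cyc (s : seq T) : rat := \sum_(p <- zip s (rot 1 s)) h p.1 p.2.

Fixpoint walk (x : T) (s : seq T) : rat :=
  if s is y :: s' then h x y + walk y s' else 0.

Lemma walk_cat x s t : walk x (s ++ t) = walk x s + walk (last x s) t.
Proof. by elim: s x => [|y s IH] x /=; rewrite ?add0r // IH addrA. Qed.

Lemma cyc_cons x s : cyc (x :: s) = walk x (rcons s x).
Proof.
(* The closing vertex is separated from the starting one so that the induction can move the
   latter. *)
rewrite /cyc rot1_cons; move: {2 4}x => z; elim: s x => [|y s IH] x /=.
  by rewrite big_seq1 addr0.
by rewrite big_cons IH.
Qed.

Lemma cyc_catC s t : cyc (s ++ t) = cyc (t ++ s).
Proof.
case: s t => [|x s] [|y t]; rewrite ?cats0 //= !cyc_cons.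
by rewrite !rcons_cat /= -!cat_rcons !walk_cat !last_rcons addrC.
Qed.

(** Insert the tour of [v] right after [u]; the return through [v] and [u] is shortcut by the
    triangle inequality. For empty [a] the shortcut needs [0 <= h u u], the triangle inequality at
    [u], [u], [u]. *)
Lemma cyc_merge u a v b :
  cyc (u :: v :: b ++ a) <= cyc (u :: a) + cyc (v :: b) + (h u v + h v u).
Proof.
rewrite !cyc_cons /= rcons_cat walk_cat -[rcons b v]cats1 walk_cat /=.
set l := last v b.
have : walk l (rcons a u) <= h l v + h v u + walk u (rcons a u).
  case: a => [|z a] /=.
    have := h_triangle l v u; have := h_triangle u v u; have := h_triangle v u v.
    have := h_triangle u u u; lra.
  have := h_triangle l v z; have := h_triangle v u z; lra.
lra.
Qed.

(** [k] stands for the total resistance of a tree spanning [A], whose edges have commute time [m]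
    times their resistance; the tree itself is not recorded. *)
Definition tour m (A : {set T}) (k : rat) :=
  exists2 s, perm_eq s (enum A) & cyc s <= m * k.

Lemma tour1 m x : h x x = 0 -> tour m [set x] 0.
Proof.
move=> hxx; exists [:: x]; first by rewrite enum_set1.
by rewrite cyc_cons /= hxx mulr0 addr0.
Qed.

Lemma tour_from m A k u : tour m A k -> u \in A ->
  exists2 s, perm_eq (u :: s) (enum A) & cyc (u :: s) <= m * k.
Proof.
move=> [s sA sk] uA; have us : u \in s by rewrite (perm_mem sA) mem_enum.
have [i s' rs] := rot_to us; exists s'; rewrite -rs; first by rewrite perm_rot.
by rewrite /rot cyc_catC cat_take_drop.
Qed.

Lemma tour_merge m (R : T -> T -> rat) A B k l u v :
  (forall x y, h x y + h y x = m * R x y) ->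
  tour m A k -> tour m B l -> [disjoint A & B] -> u \in A -> v \in B ->
  tour m (A :|: B) (k + l + R u v).
Proof.
move=> hR tA tB dAB uA vB.
have [a aA ak] := tour_from tA uA; have [b bB bl] := tour_from tB vB.
exists (u :: v :: b ++ a); last first.
  by have := cyc_merge u a v b; rewrite hR; lra.
apply: (@perm_trans _ ((u :: a) ++ (v :: b))).
  by rewrite /= perm_cons -cat_cons perm_catC.
apply: uniq_perm.
- rewrite cat_uniq (perm_uniq aA) (perm_uniq bB) !enum_uniq andTb andbT.
  apply/hasPn => x; rewrite (perm_mem bB) (perm_mem aA) !mem_enum => xB.
  by have := disjointFl dAB xB => ->.
- exact: enum_uniq.
by move=> x; rewrite mem_cat (perm_mem bB) (perm_mem aA) !mem_enum inE.
Qed.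

End CyclicTour.

Lemma sum_setU (T : finType) (A B : {set T}) (F : T -> rat) :
  [disjoint A & B] ->
  \sum_(x in A :|: B) F x = \sum_(x in A) F x + \sum_(x in B) F x.
Proof. by move=> dAB; rewrite -bigU //; apply: eq_bigl => x; rewrite !inE. Qed.

(** * Amortized analysis of Kruskal's algorithm *)

Section SpanningTree.
Variables (T : finType) (e : rel T) (c R : T -> T -> rat).
Hypothesis e_sym : symmetric e.
Hypothesis e_conn : forall x y, connect e x y.
Hypothesis c_ge0 : forall u w, 0 <= c u w.
Hypothesis c_sym : forall u w, c u w = c w u.
Hypothesis c_nonedge : forall u w, ~~ e u w -> c u w = 0.
Hypothesis c_deg : forall u w, e u w -> 1 <= c u w * (deg e u)%:R.
Hypothesis R_ge0 : forall u w, 0 <= R u w.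
Hypothesis R_sym : forall u w, R u w = R w u.
Hypothesis R_deg : forall u w, e u w -> R u w <= (deg e u)%:R.

Implicit Types (A B : {set T}) (k t : rat).

Definition nbr u A : rat := \sum_(w in A) (e u w)%:R.
Definition flux u A : rat := \sum_(w in A) c u w.
Definition cut A B : rat := \sum_(u in A) flux u B.
Definition energy A B : rat := \sum_(u in A) \sum_(w in B) c u w * R u w.

(* [k] is the weight of the tree built inside [A].  Boundary edges count only up to
   [t]; the two orientations of an inner edge count 6 instead of the 4 this gives,
   which releases a credit of twice [c * R] when the edge becomes inner. *)
Definition slack A k t : rat :=
  2 * #|A|%:R + 3 * energy A A + t * (2 * cut A (~: A) - 1) - k.

(* The last clause is what [A] contributes to the second one for [u] when [A] is merged
   into the component of [u]: the edges from [u] to [A] become inner. *)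
Definition invariant A k t : Prop :=
  [/\ 0 <= slack A k t,
      forall u, u \in A ->
        (deg e u)%:R - t <= slack A k t \/ 2 * nbr u A <= slack A k t &
      forall u, u \notin A -> 2 * nbr u A <= slack A k t + 2 * t * flux u A].

Lemma flux_ge0 u A : 0 <= flux u A. Proof. exact: sumr_ge0. Qed.

Lemma cutC A B : cut A B = cut B A.
Proof.
rewrite /cut /flux exchange_big /=; apply: eq_bigr => u _.
by apply: eq_bigr => w _.
Qed.

Lemma energyC A B : energy A B = energy B A.
Proof.
rewrite /energy exchange_big /=; apply: eq_bigr => u _.
by apply: eq_bigr => w _; rewrite c_sym R_sym.
Qed.

Lemma flux_le_cut u A B : u \in A -> flux u B <= cut A B.
Proof.
move=> uA; rewrite /cut (bigD1 u) //= lerDl.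
by apply: sumr_ge0 => w _; apply: flux_ge0.
Qed.

Lemma nbr_le_flux u A (D : rat) :
  (forall w, w \in A -> e u w -> 1 <= c u w * D) -> nbr u A <= D * flux u A.
Proof.
move=> cD; rewrite mulr_sumr; apply: ler_sum => w wA.
have [euw|/c_nonedge->] := boolP (e u w); last by rewrite mulr0.
by rewrite mulrC cD.
Qed.

Lemma nbr_setU u A B :
  [disjoint A & B] -> nbr u (A :|: B) = nbr u A + nbr u B.
Proof. exact: sum_setU. Qed.

Lemma flux_setU u A B :
  [disjoint A & B] -> flux u (A :|: B) = flux u A + flux u B.
Proof. exact: sum_setU. Qed.

Lemma disjoint_setC A : [disjoint A & ~: A].
Proof. by rewrite -setI_eq0 setICr. Qed.

Lemma deg_nbr u A : (deg e u)%:R = nbr u A + nbr u (~: A).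
Proof.
rewrite -nbr_setU ?disjoint_setC // setUCr /deg /nbr -natr_sum -sum1dep_card.
congr _%:R; rewrite big_mkcond; apply: eq_big => w; first by rewrite !inE.
by case: (e u w).
Qed.

(** The initial credit 2 per vertex in [slack] is what one edge into [x] demands in the last
    clause. *)
Lemma invariant1 x : ~~ e x x -> invariant [set x] 0 0.
Proof.
move=> exx; have n1 u : nbr u [set x] = (e u x)%:R by rewrite /nbr big_set1.
have en : 0 <= energy [set x] [set x].
  by apply: sumr_ge0 => u _; apply: sumr_ge0 => w _; apply: mulr_ge0.
have s2 : 2 <= slack [set x] 0 0 by rewrite /slack cards1; lra.
split; first by lra.
  by move=> u; rewrite inE => /eqP->; right; rewrite n1 (negPf exx) mulr0; lra.
move=> u _; have : (e u x)%:R <= 1 :> rat by rewrite lern1 leq_b1.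
rewrite n1; lra.
Qed.

Lemma invariant_advance A k t t' u0 w0 :
  0 <= t <= t' -> u0 \in A -> w0 \notin A -> e u0 w0 ->
  (forall u w, u \in A -> w \notin A -> e u w -> t' <= R u w) ->
  invariant A k t -> invariant A k t'.
Proof.
move=> /andP[t0 tt'] u0A w0A e0 bR [I0 I1 I2].
pose b := cut A (~: A).
have sE : slack A k t' = slack A k t + (t' - t) * (2 * b - 1).
  by rewrite /slack -/b; ring.
(* If the cut is at least 1/2, [slack] does not decrease and every clause persists. Below 1/2 it
   loses at most [t' - t]. *)
have [small|large] := lerP 1 (2 * b).
  have ss : slack A k t <= slack A k t'.
    by rewrite sE lerDl mulr_ge0 // subr_ge0.
  split; first exact: le_trans ss.
    by move=> u /I1[]; [left|right]; lra.
  move=> u /I2 ?; have := ler_wpM2r (flux_ge0 u A) tt'; lra.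
have key u : u \in A -> (deg e u)%:R - t' <= slack A k t'.
  move=> uA; suff : (deg e u)%:R - t <= slack A k t.
    have : (t' - t) * (2 * b) >= 0.
      by rewrite !mulr_ge0 ?subr_ge0 // sumr_ge0 // => *; exact: flux_ge0.
    by rewrite sE; lra.
  (* Each edge at [u] has conductance at least [1 / deg e u] and the cut is below 1/2, so at most
     half of the neighbours of [u] lie outside: [2 * nbr u A] is at least the degree. *)
  have [//|h] := I1 u uA.
  have d0 : 0 <= (deg e u)%:R :> rat by [].
  have : nbr u (~: A) <= (deg e u)%:R * flux u (~: A).
    by apply: nbr_le_flux => w _; apply: c_deg.
  have := ler_wpM2l d0 (flux_le_cut (~: A) uA).
  have : (deg e u)%:R * (2 * b) <= (deg e u)%:R * 1 :> rat.
    by apply: ler_wpM2l => //; apply: ltW.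
  have := deg_nbr u A; rewrite -/b; lra.
(* A boundary edge at [u0] gives [t' <= R u0 w0 <= deg e u0]. *)
have s0 : 0 <= slack A k t'.
  by have := key u0 u0A; have := bR _ _ u0A w0A e0; have := R_deg e0; lra.
split=> // [u uA|u uA]; first by left; apply: key.
have t'f : 0 <= t' * flux u A by rewrite mulr_ge0 ?flux_ge0 //; lra.
have [w1 /andP[w1A e1]|noedge] := pickP [pred w | (w \in A) && e u w]; last first.
  have -> : nbr u A = 0; last by lra.
  by apply: big1 => w wA; have := noedge w; rewrite /= wA /= => ->.
(* For the neighbour [w] of largest degree [D] in [A], [nbr u A <= D * flux u A], while [t' <= D]
   and [flux u A < 1/2]. Expanding [(D - t') * (1 - 2 * flux u A) >= 0] and using [key] at [w] gives
   the clause. *)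
case: (@arg_maxnP T w1 [pred w | (w \in A) && e u w] (deg e)) => /= [|w].
  by rewrite w1A.
move=> /andP[wA ew] wmax.
have : nbr u A <= (deg e w)%:R * flux u A.
  apply: nbr_le_flux => x xA ex.
  have exu : e x u by rewrite e_sym.
  have := c_deg exu; rewrite c_sym => /le_trans; apply.
  by apply: ler_wpM2l => //; rewrite ler_nat wmax // xA.
have ewu : e w u by rewrite e_sym.
have Dt : t' <= (deg e w)%:R by apply: le_trans (R_deg ewu); apply: bR.
have fb : flux u A <= b.
  by rewrite /b cutC; apply: flux_le_cut; rewrite inE.
have : 0 <= ((deg e w)%:R - t') * (1 - 2 * flux u A).
  by apply: mulr_ge0; lra.
have := key w wA; lra.
Qed.

(** The new tree edge costs [t], repaid because two terms [- t] become one. Edges between [A] and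
    [B] turn [4 * t * cut A B] into [6 * energy A B], and [energy A B >= t * cut A B]. *)
Lemma slack_merge A B k l t : [disjoint A & B] ->
  (forall u w, u \in A -> w \in B -> e u w -> t <= R u w) ->
  slack A k t + slack B l t + 2 * t * cut A B <=
  slack (A :|: B) (k + l + t) t.
Proof.
move=> dAB tR; have dBA : [disjoint B & A] by rewrite disjoint_sym.
have ->: slack (A :|: B) (k + l + t) t =
  slack A k t + slack B l t + 6 * energy A B - 4 * t * cut A B.
  have cardU : #|A :|: B|%:R = #|A|%:R + #|B|%:R :> rat.
    by rewrite -natrD cardsU (disjoint_setI0 dAB) cards0 subn0.
  have enU : energy (A :|: B) (A :|: B) =
      energy A A + energy B B + 2 * energy A B.
    have enUl X : energy (A :|: B) X = energy A X + energy B X.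
      exact: sum_setU.
    by rewrite enUl (energyC A (A :|: B)) (energyC B (A :|: B)) !enUl
      (energyC B A); ring.
  have cutU X : cut (A :|: B) X = cut A X + cut B X by apply: sum_setU.
  have cA : cut A (~: A) = cut A B + cut A (~: (A :|: B)).
    rewrite cutC (cutC A B) (cutC A (~: (A :|: B))) /cut -sum_setU.
      apply: eq_bigl => x; rewrite !inE negb_or.
      case: (boolP (x \in B)) => [xX|_]; first by rewrite (disjointFr dBA xX).
      by rewrite /= ?andbT.
    by rewrite -setI_eq0 setCU setICA setICr setI0.
  have cB : cut B (~: B) = cut A B + cut B (~: (A :|: B)).
    rewrite cutC (cutC B (~: (A :|: B))) /cut -sum_setU.
      apply: eq_bigl => x; rewrite !inE negb_or.
      case: (boolP (x \in A)) => [xX|_]; first by rewrite (disjointFr dAB xX).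
      by rewrite /= ?andbT.
    by rewrite -setI_eq0 setCU setIA setICr set0I.
  by rewrite /slack cardU enU cutU cA cB; ring.
have : t * cut A B <= energy A B.
  rewrite mulr_sumr; apply: ler_sum => u uA; rewrite mulr_sumr.
  apply: ler_sum => w wB; have [euw|/c_nonedge->] := boolP (e u w).
    by rewrite mulrC; apply: ler_wpM2l => //; apply: tR.
  by rewrite mulr0 mul0r.
lra.
Qed.

(** The released credit [2 * t * cut A B] covers the term [2 * t * flux u B] in the last clause of
    [B] for [u] in [A], and symmetrically. *)
Lemma invariant_merge A B k l t : 0 <= t -> [disjoint A & B] ->
  (forall u w, u \in A -> w \in B -> e u w -> t <= R u w) ->
  invariant A k t -> invariant B l t -> invariant (A :|: B) (k + l + t) t.
Proof.
move=> t0 dAB tR [IA0 IA1 IA2] [IB0 IB1 IB2].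
have SP := slack_merge k l dAB tR.
have cut0 : 0 <= t * cut A B.
  by rewrite mulr_ge0 // sumr_ge0 // => *; exact: flux_ge0.
split; first by lra.
  move=> u; rewrite inE nbr_setU // => /orP[uA|uB].
    have uB : u \notin B by rewrite (disjointFr dAB uA).
    have := ler_wpM2l t0 (flux_le_cut B uA); have := IB2 u uB.
    by case: (IA1 u uA) => *; [left|right]; lra.
  have uA : u \notin A by rewrite (disjointFl dAB uB).
  have := ler_wpM2l t0 (flux_le_cut A uB); rewrite cutC; have := IA2 u uA.
  by case: (IB1 u uB) => *; [left|right]; lra.
move=> u; rewrite inE negb_or nbr_setU // flux_setU // => /andP[/IA2 ? /IB2 ?].
lra.
Qed.

Lemma boundary_edge A x y : x \in A -> y \notin A ->
  exists u w, [/\ u \in A, w \notin A & e u w].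
Proof.
move=> xA yA.
have [/existsP[u /existsP[w /and3P[]]]|no] :=
    boolP [exists u, exists w, [&& u \in A, w \notin A & e u w]].
  by exists u, w.
have clA : closed e (mem A).
  apply: intro_closed; first exact: sym_connect_sym.
  move=> u w euw uA; apply: contraR no => wA.
  by apply/existsP; exists u; apply/existsP; exists w; apply/and3P.
by have := closed_connect clA (e_conn x y); rewrite /= xA (negPf yA).
Qed.

Variable Q : {set T} -> rat -> Prop.
Hypothesis e_irr : irreflexive e.
Hypothesis Q1 : forall x, Q [set x] 0.
Hypothesis Q_merge : forall A B k l u v, Q A k -> Q B l ->
  [disjoint A & B] -> u \in A -> v \in B -> e u v -> Q (A :|: B) (k + l + R u v).

(** The labelling [f] encodes the current components and the induction is on the number of labels.
    [Q] abstracts what is built along the tree, here a tour. *)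
Lemma merge_classes n (f : T -> T) t : (0 < #|T|)%N ->
  (#|[set f x | x : T]| <= n)%N -> 0 <= t ->
  (forall u w, e u w -> f u != f w -> t <= R u w) ->
  (forall x, exists2 k, Q [set y | f y == f x] k &
                        invariant [set y | f y == f x] k t) ->
  exists2 k, Q [set: T] k & k <= 2 * #|T|%:R + 3 * energy [set: T] [set: T].
Proof.
move=> T_gt0; elim: n f t => [|n IH] f t.
  have /card_gt0P[x _] := T_gt0; rewrite leqn0 cards_eq0 => /eqP im0.
  have : f x \in [set f x | x : T] by apply: imset_f.
  by rewrite im0 inE.
move=> fn t0 tR cl.
pose cross := [pred p : T * T | e p.1 p.2 && (f p.1 != f p.2)].
(* Without crossing edges, connectivity leaves one class with empty cut, and [0 <= slack] is the
   bound. Otherwise time advances to the least crossing weight [t'] in all classes, and the ends of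
   that edge are merged. *)
case: (pickP cross) => [p0 cp0|nocross]; last first.
  have /card_gt0P[x _] := T_gt0; have [k Qk [I0 _ _]] := cl x.
  have fT : [set y | f y == f x] = [set: T].
    apply/setP => y; rewrite !inE; apply/negPn/negP => fyx.
    have [||u [w [uA wA euw]]] := @boundary_edge [set y | f y == f x] x y.
    - by rewrite inE.
    - by rewrite inE.
    have := nocross (u, w); rewrite /= euw /= => /negbFE/eqP fuw.
    by move: uA wA; rewrite !inE fuw => ->.
  rewrite fT in Qk I0; exists k => //; move: I0; rewrite /slack setCT cardsT.
  have -> : cut [set: T] set0 = 0 by apply: big1 => u _; apply: big_set0.
  lra.
case: (@arg_minP _ rat _ p0 cross (fun p => R p.1 p.2) cp0).
move=> [a b] /= /andP[eab fab] abmin.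
set t' := R a b in abmin.
have tt' : 0 <= t <= t' by rewrite t0 tR.
have t'0 : 0 <= t' by apply: R_ge0.
have {cl}cl x : exists2 k, Q [set y | f y == f x] k &
    invariant [set y | f y == f x] k t'.
  have [k Qk Ik] := cl x; exists k => //.
  have [z zx] : exists z, z \notin [set y | f y == f x].
    have [fax|] := eqVneq (f a) (f x); [exists b|exists a]; rewrite inE //.
    by rewrite -fax eq_sym.
  have [|u0 [w0 [u0A w0A e0]]] := @boundary_edge [set y | f y == f x] x z _ zx.
    by rewrite inE.
  apply: invariant_advance tt' u0A w0A e0 _ Ik => u w.
  rewrite !inE => /eqP fu fw euw.
  by apply: (abmin (u, w)); rewrite /= euw fu eq_sym.
pose g y := if f y == f b then f a else f y.
have gx x : g x != f b by rewrite /g; case: ifP => // ->.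
have gcl x : g x != f a -> [set y | g y == g x] = [set y | f y == f x].
  rewrite /g => gxa; apply/setP => y; rewrite !inE.
  have [fxb|fxb] := eqVneq (f x) (f b); first by rewrite fxb !eqxx in gxa.
  rewrite (negPf fxb) in gxa; have [->|//] := eqVneq (f y) (f b).
  by rewrite eq_sym (negPf gxa) eq_sym (negPf fxb).
have gab x : g x = f a ->
    [set y | g y == g x] = [set y | f y == f a] :|: [set y | f y == f b].
  move=> ->; apply/setP => y; rewrite !inE /g.
  by case: (f y == f b); rewrite ?eqxx ?orbT ?orbF.
apply: (IH g t') => //.
- have gsub : [set g x | x : T] \subset [set f x | x : T] :\ f b.
    apply/subsetP => _ /imsetP[x _ ->]; rewrite !inE gx /=.
    by rewrite /g; case: ifP => _; apply: imset_f.
  apply: leq_trans (subset_leq_card gsub) _.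
  by move: fn; rewrite (cardsD1 (f b)) imset_f.
- move=> u w euw guw; apply: (abmin (u, w)); rewrite /= euw /=.
  by apply: contraNneq guw; rewrite /g => ->.
move=> x; have [gxa|gxa] := eqVneq (g x) (f a); last by rewrite gcl.
rewrite gab //; have [k Qk Ik] := cl a; have [l Ql Il] := cl b.
have dab : [disjoint [set y | f y == f a] & [set y | f y == f b]].
  rewrite -setI_eq0; apply/eqP/setP => y; rewrite !inE.
  by apply/negP => /andP[/eqP->]; apply/negP.
exists (k + l + t'); first by apply: Q_merge; rewrite ?inE.
apply: invariant_merge => // u w; rewrite !inE => /eqP fu /eqP fw euw.
by apply: (abmin (u, w)); rewrite /= euw fu fw.
Qed.

Lemma spanning_tree : (0 < #|T|)%N ->
  exists2 k, Q [set: T] k & k <= 2 * #|T|%:R + 3 * energy [set: T] [set: T].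
Proof.
move=> T_gt0; apply: (@merge_classes #|T| id 0) => //.
  exact: leq_imset_card.
move=> x; have -> : [set y | id y == id x] = [set x].
  by apply/setP => y; rewrite !inE.
by exists 0 => //; apply: invariant1; rewrite e_irr.
Qed.

End SpanningTree.

(** * Minimum degree conductances *)

Section MinDegree.
Variables (T : finType) (e : rel T).
Hypothesis e_sym : symmetric e.

Lemma mindeg_cond_sym u w : mindeg_cond e u w = mindeg_cond e w u.
Proof. by rewrite /mindeg_cond e_sym minnC. Qed.

Lemma deg_gt0 u w : e u w -> (0 < deg e u)%N.
Proof. by move=> euw; apply/card_gt0P; exists w; rewrite inE. Qed.

Lemma min_deg_gt0 u w : e u w -> (0 < minn (deg e u) (deg e w))%N.
Proof.
by move=> euw; rewrite leq_min (deg_gt0 euw) (@deg_gt0 w u) // e_sym.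
Qed.

Lemma mindeg_cond_gt0 u w : (0 < mindeg_cond e u w) = e u w.
Proof.
rewrite /mindeg_cond; case: ifP => euw; last by rewrite ltxx.
by rewrite invr_gt0 ltr0n min_deg_gt0.
Qed.

Lemma mindeg_cond_ge0 u w : 0 <= mindeg_cond e u w.
Proof. by rewrite /mindeg_cond; case: ifP; rewrite ?invr_ge0. Qed.

Lemma sum_inv_deg_le u : \sum_w (e u w)%:R / (deg e u)%:R <= 1 :> rat.
Proof.
rewrite -mulr_suml -natr_sum.
have -> : (\sum_w e u w = deg e u)%N.
  rewrite /deg -sum1dep_card [RHS]big_mkcond; apply: eq_bigr => w _.
  by case: (e u w).
have [->|d0] := eqVneq (deg e u) 0%N; first by rewrite mul0r.
by rewrite divff // pnatr_eq0.
Qed.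

(** The inverse of the minimum of two degrees is at most the sum of their inverses, and the inverse
    degrees sum to at most 1 around each vertex. *)
Lemma sum_mindeg_cond_le :
  \sum_u \sum_w mindeg_cond e u w <= 2 * #|T|%:R.
Proof.
pose F u w : rat := (e u w)%:R / (deg e u)%:R.
have sF : \sum_u \sum_w F u w <= #|T|%:R.
  rewrite -[leRHS]mulr1 mulr_natl -sumr_const.
  by apply: ler_sum => u _; apply: sum_inv_deg_le.
suff : \sum_u \sum_w mindeg_cond e u w <=
    \sum_u \sum_w F u w + \sum_w \sum_u F w u.
  by move/le_trans; apply; move: sF; lra.
rewrite [X in _ + X]exchange_big -big_split; apply: ler_sum => u _ /=.
rewrite -big_split; apply: ler_sum => w _ /=.
have F_ge0 x y : 0 <= F x y by rewrite divr_ge0.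
rewrite /mindeg_cond; case: ifP => euw; last by rewrite addr_ge0.
have E x y : e x y -> F x y = (deg e x)%:R^-1 by rewrite /F => ->; rewrite mul1r.
have := F_ge0 u w; have := F_ge0 w u; rewrite !E // 1?e_sym //.
by case: leqP; lra.
Qed.

End MinDegree.

Theorem theorem1 (T : finType) (e : rel T) :
  symmetric e -> irreflexive e -> (forall x y : T, connect e x y) ->
  exists s : seq T, perm_eq s (enum T) /\
    forall N : nat, cyc_partial (mindeg_cond e) N s <= (18 * #|T| ^ 2)%:R.
Proof.
move=> e_sym e_irr e_conn; set c := mindeg_cond e.
have c_sym := mindeg_cond_sym e_sym; have c_ge0 := mindeg_cond_ge0 e.
have [T0|T_gt0] := posnP #|T|.
  exists (enum T); split=> // N.
  by rewrite (size0nil (etrans (esym (cardE T)) T0)) /cyc_partial big_nil.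
have c_conn x y : connect [rel u w | 0 < c u w] x y.
  rewrite (eq_connect (e' := e)) // => u w /=; exact: mindeg_cond_gt0.
have [h [R [[hvv h_ge0 hE h_tri hR] [R_ge0 R_sym cR1 foster]]]] :=
  hitting_resistance c_ge0 c_sym c_conn T_gt0.
set m := (\sum_x \sum_y c x y) in hR.
have c_nonedge u w : ~~ e u w -> c u w = 0.
  by rewrite /c /mindeg_cond => /negPf->.
have c_deg u w : e u w -> 1 <= c u w * (deg e u)%:R.
  move=> euw; rewrite /c /mindeg_cond euw mulrC ler_pdivlMr.
    by rewrite mul1r ler_nat geq_minl.
  by rewrite ltr0n min_deg_gt0.
have R_deg u w : e u w -> R u w <= (deg e u)%:R.
  move=> euw; have := cR1 u w; rewrite /mindeg_cond euw mulrC.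
  rewrite ler_pdivrMr ?ltr0n ?min_deg_gt0 // mul1r => /le_trans; apply.
  by rewrite ler_nat geq_minl.
have merge A B k l u v : tour h m A k -> tour h m B l -> [disjoint A & B] ->
    u \in A -> v \in B -> e u v -> tour h m (A :|: B) (k + l + R u v).
  by move=> tA tB dAB uA vB _; apply: tour_merge.
have [k [s sT sk] kn] := spanning_tree e_sym e_conn c_ge0 c_sym c_nonedge c_deg
  R_ge0 R_sym R_deg e_irr (fun x => tour1 m (hvv x)) merge T_gt0.
exists s; split.
  by apply: perm_trans sT _; rewrite enum_setT -enumT.
move=> N; have : cyc_partial c N s <= cyc h s.
  apply: ler_sum => p _; apply: (hitN_le (h := h^~ p.2) c_ge0) => // x.
  exact: hE.
move/le_trans; apply; apply: le_trans sk _.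
have en : energy c R [set: T] [set: T] = 2 * (#|T|%:R - 1).
  rewrite -foster; apply: eq_big => u; rewrite ?inE // => _.
  by apply: eq_bigl => w; rewrite inE.
have m2 : m <= 2 * #|T|%:R := sum_mindeg_cond_le e_sym.
have m0 : 0 <= m by apply: sumr_ge0 => u _; apply: sumr_ge0.
have n1 : 1 <= #|T|%:R :> rat by rewrite ler1n.
(* The tree weight is at most [2 n + 3 * 2 (n - 1) <= 8 n]; with [m <= 2 n] the cost is at most
   [16 n^2]. *)
apply: (@le_trans _ _ (m * (8 * #|T|%:R))).
  by apply: ler_wpM2l => //; lra.
rewrite natrM natrX; nra.
Qed.
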